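(* Let $X$ be a set equipped with the cofinite topology. The stature $||X||$ is the cardinality of $X$ if $X$ is finite, and $\omega$ otherwise.
   Context: In the cofinite topology on a set $X$, the closed subsets are exactly the finite subsets of $X$ and $X$ itself; such a space is always Noetherian (every open subset is compact). For a well-founded poset $P$ and $x \in P$, $\mathrm{rk}_P(x) = \sup_{x' < x} (\mathrm{rk}_P(x')+1)$ and the ordinal rank of $P$ is $|P| = \sup_{x \in P} (\mathrm{rk}_P(x)+1)$, where $\sup\emptyset = 0$. $\mathcal{H}_0 X$ is the poset of all closed subsets of $X$ (including $\emptyset$), ordered by inclusion; it is well-founded when $X$ is Noetherian. The stature of a Noetherian space $X$ is $||X|| = |\mathcal{H}_0 X| - 1$, equivalently $||X|| = \mathrm{rk}_{\mathcal{H}_0 X}(X)$. *)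

(* Defs.v *)
From HB Require Import structures.
From mathcomp Require Import all_boot all_order.
From mathcomp Require Import boolp classical_sets functions cardinality.
From mathcomp Require Import topology.

Set Implicit Arguments.
Unset Strict Implicit.
Unset Printing Implicit Defensive.
Local Open Scope classical_set_scope.

(* Ordinals as well-founded trees: [OrdLim f] denotes sup_i (f i + 1).        *)
(* Distinct trees may denote the same ordinal, so equality of ordinals is     *)
(* [=o], not Leibniz equality.                                                *)
Inductive ord : Type := OrdLim (I : Type) (f : I -> ord).

(* sup_i (f i + 1) <= b = sup_j (g j + 1) iff every f i is < b, i.e. iff for  *)
(* every i there is a j such that f i <= g j.                                 *)
Fixpoint ord_le (a b : ord) : Prop :=
  match a, b with
  | OrdLim A f, OrdLim B g => forall i : A, exists j : B, ord_le (f i) (g j)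
  end.

Definition ord_eq (a b : ord) : Prop := ord_le a b /\ ord_le b a.

Declare Scope ord_scope.
Delimit Scope ord_scope with ord.
Notation "a <=o b" := (ord_le a b) (at level 70, no associativity) : ord_scope.
Notation "a =o b" := (ord_eq a b) (at level 70, no associativity) : ord_scope.
Local Open Scope ord_scope.

Definition ord_succ (a : ord) : ord := OrdLim (fun _ : unit => a).

Definition ord_lt (a b : ord) : Prop := ord_succ a <=o b.
Notation "a <o b" := (ord_lt a b) (at level 70, no associativity) : ord_scope.

Definition ord_idx (a : ord) : Type := let: OrdLim A _ := a in A.
Definition ord_sub (a : ord) : ord_idx a -> ord :=
  let: OrdLim _ f := a in f.

Definition ord_sup (I : Type) (a : I -> ord) : ord :=
  OrdLim (fun p : {i : I & ord_idx (a i)} => ord_sub (projT2 p)).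

(* a - 1, computed as the supremum of the ordinals below a; it is the b such  *)
(* that a = b + 1 when there is one (see [ord_predK]).                        *)
Definition ord_pred (a : ord) : ord := ord_sup (@ord_sub a).

Fixpoint ord_nat (n : nat) : ord :=
  if n is m.+1 then ord_succ (ord_nat m) else OrdLim (of_void ord).

Definition omega : ord := ord_sup ord_nat.

Lemma ord_le_refl a : a <=o a.
Proof. by elim: a => I f IH /= i; exists i. Qed.

Lemma ord_le_trans b a c : a <=o b -> b <=o c -> a <=o c.
Proof.
elim: a b c => I f IH [J g] [K h] /= ab bc i.
have [j fg] := ab i; have [k gh] := bc j.
by exists k; apply: IH fg gh.
Qed.

Lemma ord_lt_sub a (i : ord_idx a) : ord_sub i <o a.
Proof. by case: a i => I f i /= _; exists i; apply: ord_le_refl. Qed.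

Lemma ord_leP a b : a <=o b <-> forall i : ord_idx a, ord_sub i <o b.
Proof.
case: a b => I f [J g] /=; split => [ab i _|ab i]; first exact: ab.
exact: (ab i tt).
Qed.

Lemma ord_leNgt a b : a <=o b \/ b <o a.
Proof.
elim: a b => I f IH b; have [|nab] := pselect (OrdLim f <=o b); first by left.
right; suff [i bi] : exists i, b <=o f i.
  by move=> _; exists i.
apply: contrapT => nb; apply: nab; case: b nb => J g nb /= i.
apply: contrapT => ngi; apply: nb; exists i; case: (f i) (IH i) ngi.
move=> K h IHi ngi /= j; case: (IHi (g j)) => [le|lt].
  by case: ngi; exists j.
by have [k] := lt tt; exists k.
Qed.

Lemma ord_lt_wf : well_founded ord_lt.
Proof.
suff H a b : b <=o a -> Acc ord_lt b by move=> a; apply: (H a); exact: ord_le_refl.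
elim: a b => I f IH [J g] /= ba; constructor => c c_lt.
have [j cj] := c_lt tt; have [i ji] := ba j.
exact: IH i c (ord_le_trans cj ji).
Qed.

Lemma ord_le_sup (I : Type) (a : I -> ord) i : a i <=o ord_sup a.
Proof.
case E : (a i) => [J g] /= j.
have {}E : exists k : ord_idx (a i), ord_sub k = g j by rewrite E; exists j.
by have [k <-] := E; exists (existT _ i k); apply: ord_le_refl.
Qed.

Lemma ord_sup_le (I : Type) (a : I -> ord) b :
  (forall i, a i <=o b) -> ord_sup a <=o b.
Proof.
move=> ab; apply/ord_leP => -[i k] /=.
exact: ord_le_trans (ord_lt_sub k) (ab i).
Qed.

Lemma ord_succ_le a b : ord_succ a <=o ord_succ b <-> a <=o b.
Proof. by split => [/(_ tt)[_]|ab _]; last exists tt. Qed.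

Lemma ord_pred_le a b : a <=o b -> ord_pred a <=o ord_pred b.
Proof.
case: a b => I f [J g] ab; apply: ord_sup_le => i /=.
by have [j fg] := ab i; apply: ord_le_trans fg (@ord_le_sup J g j).
Qed.

Lemma ord_predK a b : a =o ord_succ b -> ord_pred a =o b.
Proof.
move=> [ab ba]; split.
  apply: ord_le_trans (ord_pred_le ab) _.
  by apply: ord_sup_le => -[]; exact: ord_le_refl.
by apply: ord_le_trans (ord_pred_le ba); exact: (@ord_le_sup unit (fun=> b) tt).
Qed.

Section Rank.
Context {d : Order.disp_t} (P : porderType d).
Hypothesis wfP : well_founded (fun x y : P => (x < y)%O).

Definition rk : P -> ord :=
  Fix wfP (fun _ => ord) (fun x rk_below =>
    ord_sup (fun y : {y : P | (y < x)%O} =>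
      ord_succ (rk_below (sval y) (svalP y)))).

Lemma rkE x :
  rk x = ord_sup (fun y : {y : P | (y < x)%O} => ord_succ (rk (sval y))).
Proof.
rewrite {1}/rk Fix_eq // => {}x f g fg.
by congr ord_sup; apply/funext => y; rewrite fg.
Qed.

Definition ordinal_rank : ord := ord_sup (fun x : P => ord_succ (rk x)).

End Rank.

HB.mixin Record isNoetherian T & Topological T := {
  open_compact : forall U : set T, open U -> compact U
}.

#[short(type="noetherianType")]
HB.structure Definition Noetherian := {T of Topological T & isNoetherian T}.

Section ClosedSets.
Variable X : topologicalType.

(* Ordered as a subtype of [set X], that is, by inclusion. *)
Definition H0 : Type := {C : set X | `[< closed C >]}.
HB.instance Definition _ := SubChoice.on H0.
HB.instance Definition _ := [SubChoice_isSubPOrder of H0 by <: with set_display].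

Lemma H0_leE (C D : H0) : (C <= D)%O <-> val C `<=` val D.
Proof. by split=> /asboolP. Qed.

Lemma H0_ltE (C D : H0) : (C < D)%O <-> val C `<` val D.
Proof. by split=> /asboolP. Qed.

Definition H0_top : H0 := exist _ setT (asboolT closedT).

End ClosedSets.

Lemma H0_wf (X : noetherianType) : well_founded (fun C D : H0 X => (C < D)%O).
Proof.
move=> C0; apply: contrapT => nC0.
pose bad := {C : H0 X | ~ Acc (fun C D : H0 X => (C < D)%O) C}.
have step (C : bad) : {D : bad | (sval D < sval C)%O}.
  apply: cid; apply: contrapT => nD; apply: (svalP C); constructor => D DC.
  by apply: contrapT => nAcc; apply: nD; exists (exist _ D nAcc).
pose c n : bad := iter n (fun C => sval (step C)) (exist _ C0 nC0).
pose A n : set X := val (sval (c n)).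
have cA n : closed (A n) by have /asboolP := valP (sval (c n)).
have ltA n : A n.+1 `<` A n by apply/H0_ltE/(svalP (step (c n))).
have leA m n : (m <= n)%N -> A n `<=` A m.
  move=> /subnKC <-; elim: (n - m)%N => [|k IH]; first by rewrite addn0.
  by rewrite addnS; apply: subset_trans IH; case: (ltA (m + k)%N).
pose B := \bigcap_n A n.
have oU : open (~` B).
  by apply: closed_openC; apply: closed_bigI.
pose F : set_system X := [set S | exists n, A n `\` B `<=` S].
have FF : ProperFilter F.
  apply: Build_ProperFilter_ex => [S [n AS]|].
    have [_ /existsNP[x /not_implyP[Ax nAx]]] := ltA n.
    by exists x; apply: AS; split=> // /(_ n.+1 I).
  split; first by exists 0.
    move=> S T [m AS] [n AT]; exists (maxn m n) => x [Ax Bx].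
    by split; [apply: AS|apply: AT]; split=> //; apply: leA Ax;
      rewrite ?leq_maxl ?leq_maxr.
  by move=> S T ST [n AS]; exists n; apply: subset_trans ST.
have FU : F (~` B) by exists 0 => x [].
have [p [/existsNP[n /not_implyP[_ nAp]] clp]] := open_compact _ oU _ FF FU.
have Fn : F (A n) by exists n => x [].
have np : nbhs p (~` A n).
  by apply: open_nbhs_nbhs; split=> //; apply: closed_openC.
by have [x []] := clp _ _ Fn np.
Qed.

Definition stature (X : noetherianType) : ord :=
  ord_pred (ordinal_rank (@H0_wf X)).

Lemma ordinal_rank_H0 (X : noetherianType) :
  ordinal_rank (@H0_wf X) =o ord_succ (rk (@H0_wf X) (H0_top X)).
Proof.
split; last exact: (ord_le_sup (fun C : H0 X => ord_succ (rk (@H0_wf X) C))).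
apply: ord_sup_le => C; apply/ord_succ_le; rewrite !rkE.
apply: ord_sup_le => -[D DC].
have DT : (D < H0_top X)%O.
  by apply: (Order.POrderTheory.lt_le_trans DC); apply/H0_leE.
exact: (ord_le_sup (fun y : {y : H0 X | (y < H0_top X)%O} =>
  ord_succ (rk (@H0_wf X) (sval y))) (exist _ D DT)).
Qed.

Lemma stature_rk (X : noetherianType) :
  stature X =o rk (@H0_wf X) (H0_top X).
Proof. exact: ord_predK (ordinal_rank_H0 X). Qed.

Definition cofinite (X : Type) : Type := X.

Section Cofinite.
Variable X : Type.

HB.instance Definition _ := gen_eqMixin (cofinite X).
HB.instance Definition _ := gen_choiceMixin (cofinite X).

Let op : set_system (cofinite X) := [set U | U = set0 \/ cofinite_set U].

Let opT : op setT.
Proof. by right; exact: cofinite_setT. Qed.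

Let opI : setI_closed op.
Proof.
move=> U V [->|fU]; first by rewrite set0I; left.
move=> [->|fV]; first by rewrite setI0; left.
by right; rewrite setCI finite_setU.
Qed.

Let op_bigU (I : Type) (f : I -> set (cofinite X)) :
  (forall i, op (f i)) -> op (\bigcup_i f i).
Proof.
move=> opf; have [[i fi]|nf] := pselect (exists i, cofinite_set (f i)).
  by right; apply: sub_finite_set fi; apply: subsetC => x fx; exists i.
left; rewrite -subset0 => x [i _]; case: (opf i) => [-> //|fi].
by case: nf; exists i.
Qed.

HB.instance Definition _ :=
  isOpenTopological.Build (cofinite X) opT opI op_bigU.

Lemma cofinite_closedE (C : set (cofinite X)) :
  closed C <-> finite_set C \/ C = setT.
Proof.
have oE U : open U <-> op U by [].
rewrite -openC oE /op /=; split => -[].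
- by move=> C0; right; rewrite -(setCK C) C0 setC0.
- by rewrite setCK; left.
- by right; rewrite setCK.
- by move=> ->; left; rewrite setCT.
Qed.

Let cofinite_open_compact (U : set (cofinite X)) : open U -> compact U.
Proof.
move=> _ F FF FU.
have [[B [FB fB]]|nB] := pselect (exists B, F B /\ finite_set B).
  have [|p [[Up _] Fp]] := @finite_compact _ (U `&` B) _ F FF (filterI FU FB).
    exact: finite_setIr.
  by exists p.
have [p Up] := filter_ex FU; exists p; split=> // S V FS.
move=> [W [[W0|fW] Wp WV]]; first by rewrite W0 in Wp.
have [x [Sx Wx]] : S `&` W !=set0; last by exists x; split=> //; exact: WV.
apply: contrapT => SW0; apply: nB; exists S; split=> //.
by apply: sub_finite_set fW => x Sx Wx; apply: SW0; exists x.
Qed.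

HB.instance Definition _ :=
  isNoetherian.Build (cofinite X) cofinite_open_compact.

End Cofinite.

(* Main.v *)
Require Import Defs.
From mathcomp Require Import all_boot all_order finmap.
From mathcomp Require Import boolp classical_sets functions cardinality.
From mathcomp Require Import topology.
Local Open Scope classical_set_scope.
Local Open Scope ord_scope.

(** By [stature_rk] the stature is the rank of the whole space among its closed
    subsets, which here are the finite subsets and the whole space.

    A finite set with [n] points has rank [n], by induction on [n]: removing a
    point leaves a closed set of rank [n - 1], and every proper closed subset
    is contained in a set obtained in this way ([rk_finite]).  This settles the
    case where the space is finite.  If it is infinite, its proper closed
    subsets are finite, so each has a finite rank, and it has finite subsets of
    every size, so every natural number is such a rank; the supremum of the
    successors of these ranks is omega. *)

Section RankTheory.
Context {d : Order.disp_t} {P : porderType d}.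
Variable wfP : well_founded (fun x y : P => (x < y)%O).

Lemma rk_lt (x y : P) : (x < y)%O -> rk wfP x <o rk wfP y.
Proof.
move=> xy; rewrite /ord_lt [rk wfP y]rkE.
exact: (@ord_le_sup {z : P | (z < y)%O}
  (fun z => ord_succ (rk wfP (sval z))) (exist _ x xy)).
Qed.

Lemma rk_le_sup (x : P) a :
  (forall y, (y < x)%O -> rk wfP y <o a) -> rk wfP x <=o a.
Proof. by move=> H; rewrite rkE; apply: ord_sup_le => -[y yx]; exact: H. Qed.

Lemma rk_le (x y : P) : (x <= y)%O -> rk wfP x <=o rk wfP y.
Proof.
move=> xy; apply: rk_le_sup => z zx; apply: rk_lt.
exact: Order.POrderTheory.lt_le_trans zx xy.
Qed.

End RankTheory.

Lemma card_setD1 (T : choiceType) (A : set T) x n :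
  (A #= `I_n.+1)%card -> A x -> (A `\ x #= `I_n)%card.
Proof.
move=> An Ax; have fA : finite_set A by exists n.+1.
have xA : x \in fset_set A by rewrite in_fset_set //; apply/mem_set.
rewrite -(fset_setK (finite_setD _ fA)); apply/card_eq_fsetP.
have := card_fset_set An; rewrite (cardfsD1 x) xA fset_setD1 //.
by rewrite add1n => -[].
Qed.

Section CofiniteRank.
Variable X : Type.

Local Notation rkX := (rk (@H0_wf (cofinite X))).

(** The induction never counts the points of an arbitrary subset: both bounds
    only compare [C] with the sets [C] minus a point, since every closed set
    strictly below [C] misses a point of [C] and rank is monotone. *)
Lemma rk_finite n (C : H0 (cofinite X)) :
  (val C #= `I_n)%card -> rkX C =o ord_nat n.
Proof.
elim: n C => [|n IH] C Cn.
  have C0 : val C = set0 by move: Cn; rewrite II0 card_eq0 => /eqP.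
  (* [ord_nat 0] has no index, so it lies below every ordinal. *)
  split; last by case: (rkX C) => I f [].
  by apply: rk_le_sup => D /H0_ltE; rewrite C0 => -[_ []].
have rk_remove (x : cofinite X) : val C x ->
    exists2 D : H0 (cofinite X), val D = val C `\ x & rkX D =o ord_nat n.
  move=> Cx; have Dn := @card_setD1 (cofinite X) _ _ _ Cn Cx.
  have Dclosed : closed (val C `\ x) by apply/cofinite_closedE; left; exists n.
  by exists (exist _ (val C `\ x) (asboolT Dclosed)); last exact: IH.
split.
  apply: rk_le_sup => E /H0_ltE[EC /existsNP[x /not_implyP[Cx nEx]]].
  have [D Dx [Dn _]] := rk_remove x Cx.
  apply/ord_succ_le/ord_le_trans/Dn/rk_le/H0_leE; rewrite Dx => y Ey.
  by split; [exact: EC|move=> yx; apply: nEx; rewrite -yx].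
have [x Cx _] := eq_cardSP _ _ Cn; have [D Dx [_ nD]] := rk_remove x Cx.
apply: (@ord_le_trans (ord_succ (rkX D))); first exact/ord_succ_le.
apply/rk_lt/H0_ltE; rewrite Dx; split; first exact: subDsetl.
by move=> /(_ x Cx)[_]; exact.
Qed.

Lemma rk_infinite :
  infinite_set [set: X] -> rkX (H0_top (cofinite X)) =o omega.
Proof.
move=> infX; split.
  apply: rk_le_sup => C /H0_ltE[_ nTC].
  have [[n Cn]|CT] : finite_set (val C) \/ val C = setT.
    exact/cofinite_closedE/asboolP/(valP C).
  - have [Cle _] := rk_finite n C Cn.
    apply: (@ord_le_trans (ord_nat n.+1)); last exact: ord_le_sup.
    exact/ord_succ_le.
  - by case: nTC; rewrite CT.
apply: ord_sup_le => n.
have [A nA _] : exists2 A : set X, (A #= `I_n)%card & A `<=` setT.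
  have : (`I_n #<= [set: X])%card.
    apply: card_le_trans; last exact/infiniteP.
    exact: subset_card_le.
  by move=> /card_subP[A nA AX]; exists A.
have Aclosed : closed (A : set (cofinite X)).
  by apply/cofinite_closedE; left; exists n.
pose C : H0 (cofinite X) := exist _ A (asboolT Aclosed).
have [_ nC] := rk_finite n C nA.
by apply: ord_le_trans nC _; apply/rk_le/H0_leE.
Qed.

End CofiniteRank.

Theorem theorem7p2 (X : Type) :
  (forall n : nat, ([set: X] #= `I_n)%card -> stature (cofinite X) =o ord_nat n) /\
  (infinite_set [set: X] -> stature (cofinite X) =o omega).
Proof.
have rk_stature a : rk (@H0_wf (cofinite X)) (H0_top (cofinite X)) =o a ->
    stature (cofinite X) =o a.
  have [srk rks] := stature_rk (cofinite X); move=> [ra ar].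
  by split; [exact: ord_le_trans srk ra|exact: ord_le_trans ar rks].
split=> [n Xn|infX]; apply: rk_stature; first exact: rk_finite.
exact: rk_infinite.
Qed.
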